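(* Let $\Omega=(0,1)$ and $f\in L^1(\Omega)$. For $s\in(0,1)$ write $\Gamma_t(x)=-\frac{|x-t|}{2}$, $a_s=\frac{1}{s(1-s)}$, and let $$\phi_s(x)=2\left(\Gamma_s(x)-\frac{\Gamma_s(x)-\Gamma_{-s}(x)}{\Gamma_s(1)-\Gamma_{-s}(1)}\Gamma_s(1)-\frac{\Gamma_s(x)-\Gamma_{2-s}(x)}{\Gamma_s(0)-\Gamma_{2-s}(0)}\Gamma_s(0)\right),\qquad \Phi:s\mapsto\phi_s.$$ (1) A function $\overline u\in H^1(\Omega)$ is a $\Phi$-Green-representable super-solution if there exists a constant $c\ge0$ such that $$\int_0^1\overline u'(x)\phi_s'(x)\,dx+c\,a_s\ge\int_0^1f(x)\phi_s(x)\,dx\quad\text{for all }s\in(0,1),$$ and $\overline u-c\ge0$ on $\partial\Omega=\{0,1\}$. (2) A function $\underline u\in H^1(\Omega)$ is a $\Phi$-Green-representable sub-solution if there exists a constant $c\ge0$ such that $$\int_0^1\underline u'(x)\phi_s'(x)\,dx-c\,a_s\le\int_0^1f(x)\phi_s(x)\,dx\quad\text{for all }s\in(0,1),$$ and $\underline u+c\le0$ on $\partial\Omega=\{0,1\}$.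
   Context: Functions in $W^{1,q}(0,1)$ are identified with their continuous representatives on $[0,1]$. $\phi_s$ has coefficient $a_s$ in front of $\Gamma_s$. Coupling: $\langle\nabla w,\nabla\phi_s\rangle:=a_sw(s)+w(1)\phi_s'(1)-w(0)\phi_s'(0)$, where $\phi_s'(1)$ and $-\phi_s'(0)$ are the outward normal derivatives of $\phi_s$ at $1$ and $0$. Definition (for the equation $-u''=f$ in $\Omega$, $u=0$ on $\partial\Omega$): a function $\overline u\in W^{1,q}(\Omega)$ with some $q>1$ is a $\Phi$-Green-representable super-solution if for every $s\in\Omega$ $$\langle\nabla\overline u,\nabla\phi_s\rangle\ge\int_0^1f\phi_s\,dx+\overline u(1)\phi_s'(1)-\overline u(0)\phi_s'(0),$$ and $\overline u\ge0$ on $\partial\Omega$. A $\Phi$-Green-representable sub-solution $\underline u\in W^{1,q}(\Omega)$ with some $q>1$ is defined by the reversed inequalities: $\langle\nabla\underline u,\nabla\phi_s\rangle\le\int_0^1f\phi_s\,dx+\underline u(1)\phi_s'(1)-\underline u(0)\phi_s'(0)$ for every $s\in\Omega$, and $\underline u\le0$ on $\partial\Omega$. *)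

(* Defs.v *)
From mathcomp Require Import all_boot all_order all_algebra.
From mathcomp Require Import all_classical all_reals all_analysis.

Set Implicit Arguments.
Unset Strict Implicit.
Unset Printing Implicit Defensive.

Import Order.TTheory GRing.Theory Num.Theory.
Import numFieldNormedType.Exports.

Local Open Scope classical_set_scope.
Local Open Scope ring_scope.

Section Sobolev.
Context {R : realType}.
Local Notation mu := (@lebesgue_measure R).
Implicit Types u du eta f : R -> R.

Definition Omega : set R := `]0, 1[.

(* L^q(0,1): [f] is cut off by 0 outside (0,1). *)
Definition Lq (q : R) f : Prop := (f \_ Omega : R -> R) \in Lfun mu q%:E.

(* C_c^oo(0,1), with functions extended by 0 to the real line; the support,
   being closed and contained in the bounded set (0,1), is compact. *)
Definition test_function eta : Prop :=
  (forall n x, derivable (derive1n n eta) x 1) /\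
  closure [set x | eta x != 0] `<=` Omega.

Definition weak_derivative u du : Prop :=
  forall eta, test_function eta ->
    \int[mu]_(x in Omega) (u x * derive1 eta x) =
    - \int[mu]_(x in Omega) (du x * eta x).

(* [u] is (the continuous representative on [0,1] of) an element of W^{1,q}(0,1)
   whose derivative is (represented by) [du]. *)
Definition sobolev1_with_derivative (q : R) u du : Prop :=
  [/\ {within `[0, 1], continuous u}, Lq q u, Lq q du & weak_derivative u du].

Definition sobolev1 (q : R) u : Prop :=
  exists du, sobolev1_with_derivative q u du.

End Sobolev.

Section GreenRepresentable.
Context {R : realType}.
Local Notation mu := (@lebesgue_measure R).

(* [phi s] is the test function attached to [s] and [a s] the coefficient of
   Gamma_s in [phi s], so that - (phi s)'' = a s * delta_s in (0,1). *)
Variables (a : R -> R) (phi : R -> R -> R) (f : R -> R).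

Definition coupling (w : R -> R) (s : R) : R :=
  a s * w s + w 1 * derive1 (phi s) 1 - w 0 * derive1 (phi s) 0.

Definition green_supersolution (u : R -> R) : Prop :=
  [/\ exists2 q : R, 1 < q & sobolev1 q u,
      forall s, 0 < s < 1 ->
        \int[mu]_(x in Omega) (f x * phi s x)
          + u 1 * derive1 (phi s) 1 - u 0 * derive1 (phi s) 0 <= coupling u s,
      0 <= u 0 & 0 <= u 1].

Definition green_subsolution (u : R -> R) : Prop :=
  [/\ exists2 q : R, 1 < q & sobolev1 q u,
      forall s, 0 < s < 1 ->
        coupling u s <= \int[mu]_(x in Omega) (f x * phi s x)
          + u 1 * derive1 (phi s) 1 - u 0 * derive1 (phi s) 0,
      u 0 <= 0 & u 1 <= 0].

End GreenRepresentable.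

Section GreenFamily.
Context {R : realType}.

Definition Gamma (t x : R) : R := - (`|x - t| / 2).

Definition coef (s : R) : R := 1 / (s * (1 - s)).

(* For 0 < s < 1 this is the hat function with phi s 0 = phi s 1 = 0 and
   phi s s = 1. The formula makes sense on the whole line and is affine on
   (-s,s) and on (s,2-s), so its two-sided derivatives at 0 and 1 are the
   one-sided ones from [0,1]; on (0,1) the derivative exists except at s. *)
Definition phi (s x : R) : R :=
  2 * (Gamma s x
       - (Gamma s x - Gamma (- s) x) / (Gamma s 1 - Gamma (- s) 1) * Gamma s 1
       - (Gamma s x - Gamma (2 - s) x) / (Gamma s 0 - Gamma (2 - s) 0)
           * Gamma s 0).

End GreenFamily.

(* Main.v *)
Require Import Defs.
From mathcomp Require Import all_boot all_order all_algebra.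
From mathcomp Require Import all_classical all_reals all_analysis.
From mathcomp Require Import measurable_realfun ring lra.

(** Write [I s] for the integral over (0,1) of u' phi_s'. As phi_s is the hat
    function with peak phi_s(s) = 1, its slope is 1/s on (0,s) and -1/(1-s) on
    (s,1), so the fundamental theorem of calculus for u gives
      I s = (u(s) - u(0)) / s - (u(1) - u(s)) / (1 - s)
          = a_s u(s) - u(0) / s - u(1) / (1 - s),
    because a_s = 1/s + 1/(1-s) ([integral_derive1_phi]). The boundary terms
    phi_s'(0) and phi_s'(1) occur identically on both sides of the
    Green-representability inequality, which therefore reads
    int f phi_s <= a_s u(s). From the hypothesis
      int f phi_s <= I s + c a_s
                   = a_s u(s) - (u(0) - c) / s - (u(1) - c) / (1 - s),
    and the last two terms are nonpositive since u - c >= 0 at 0 and at 1. The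
    sub-solution case is the same with all inequalities reversed.

    What needs work is the fundamental theorem of calculus for a function that
    is continuous on [0,1] and has an integrable weak derivative
    ([weak_derivative_FTC]): u(b) - u(a) = int_a^b u' for 0 <= a < b <= 1. It
    results from testing the weak derivative against smooth cutoffs eta_e that
    rise from 0 to 1 on [a+e, a+2e] and fall from 1 to 0 on [b-2e, b-e]. As e
    tends to 0, int u' eta_e tends to int_a^b u' by dominated convergence
    ([integral_cutoff]), while eta_e' is the difference of two kernels of mass
    1 that concentrate at a and at b, whence int u eta_e' tends to u(a) - u(b)
    by continuity of u ([integral_derive1_cutoff]). The supports of the cutoffs
    stay strictly inside (0,1) even when a = 0 or b = 1, so the endpoints
    require no separate passage to the limit. The cutoffs are built from a
    smooth step g(x) / (g(x) + g(1-x)) with g(x) = exp(-1/x) for x > 0 and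
    g(x) = 0 for x <= 0. *)

Set Implicit Arguments.
Unset Strict Implicit.
Unset Printing Implicit Defensive.

Import Order.TTheory GRing.Theory Num.Theory.
Import numFieldNormedType.Exports.

Local Open Scope classical_set_scope.
Local Open Scope ring_scope.

(** * Smooth functions on the line *)

Section Smooth.
Context {R : realType}.
Implicit Types (f g : R -> R) (n : nat).

(** Derivatives are peeled from the inside, so that the closure properties below
    follow by induction on the order from the rule for the first derivative. *)
Fixpoint times_derivable n f : Prop :=
  if n is m.+1
  then (forall x, derivable f x 1) /\ times_derivable m (derive1 f)
  else True.

Definition smooth f := forall n, times_derivable n f.

Lemma smooth_derivable f x : smooth f -> derivable f x 1.
Proof. by move=> /(_ 1%N)[+ _]; exact. Qed.

Lemma smooth_derive1 f : smooth f -> smooth (derive1 f).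
Proof. by move=> sf n; have [] := sf n.+1. Qed.

Lemma smooth_derivable_derive1n f n x : smooth f -> derivable (derive1n n f) x 1.
Proof.
elim: n f => [|n IH] f sf; first exact: smooth_derivable.
by rewrite derive1Sn; apply: IH; exact: smooth_derive1.
Qed.

Lemma smooth_continuous f : smooth f -> continuous f.
Proof.
by move=> sf x; apply/differentiable_continuous/derivable1_diffP/smooth_derivable.
Qed.

Lemma times_derivableS n f : times_derivable n.+1 f -> times_derivable n f.
Proof. by elim: n f => [//|n IH] f [df /IH]. Qed.

Lemma times_derivable_cst n (r : R) : times_derivable n (fun=> r).
Proof.
elim: n r => [//|n IH] r; split=> [x|]; first exact: derivable_cst.
by rewrite (_ : derive1 _ = fun=> 0)//; apply/funext => x; rewrite derive1_cst.
Qed.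

Lemma times_derivableD n f g : times_derivable n f -> times_derivable n g ->
  times_derivable n (fun x => f x + g x).
Proof.
elim: n f g => [//|n IH] f g [df nf] [dg ng]; split=> [x|].
  exact: (derivableD (df x) (dg x)).
rewrite (_ : derive1 _ = fun x => derive1 f x + derive1 g x); first exact: IH.
by apply/funext => x; rewrite !derive1E; exact: deriveD.
Qed.

Lemma times_derivableM n f g : times_derivable n f -> times_derivable n g ->
  times_derivable n (fun x => f x * g x).
Proof.
elim: n f g => [//|n IH] f g nf ng.
have [df nf'] := nf; have [dg ng'] := ng; split=> [x|].
  exact: (derivableM (df x) (dg x)).
rewrite (_ : derive1 _ = fun x => f x * derive1 g x + g x * derive1 f x).
  by apply: times_derivableD; apply: IH => //; exact: times_derivableS.
by apply/funext => x; rewrite !derive1E; exact: deriveM.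
Qed.

(** The derivative - f' / f^2 involves 1/f itself, but only at the order already
    reached by the induction. *)
Lemma times_derivableV n f : (forall x, f x != 0) -> times_derivable n f ->
  times_derivable n (fun x => (f x)^-1).
Proof.
move=> f0; elim: n => [//|n IH] nf; have [df nf'] := nf.
split=> [x|]; first exact: derivableV.
have nV := IH (times_derivableS nf).
rewrite (_ : derive1 _ =
    fun x => (-1 * ((f x)^-1 * (f x)^-1)) * derive1 f x).
  apply: times_derivableM => //; apply: times_derivableM.
    exact: times_derivable_cst.
  exact: times_derivableM.
apply/funext => x; rewrite !derive1E deriveV//.
by rewrite -expr2 mulN1r exprVn.
Qed.

Lemma is_derive_affine (a b x : R) : is_derive x 1 (fun y => a * y + b) a.
Proof.
apply: (is_derive_eq
  (is_deriveD (is_deriveZ a (is_derive_id x 1)) (is_derive_cst b x 1))).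
by rewrite addr0 /GRing.scale/= mulr1.
Qed.

Lemma derive1_comp_affine f (a b x : R) : (forall y, derivable f y 1) ->
  derive1 (fun y => f (a * y + b)) x = a * derive1 f (a * x + b).
Proof.
move=> df; have [dl el] := is_derive_affine a b x.
by rewrite (derive1_comp dl (df _)) [X in _ * X]derive1E el mulrC.
Qed.

Lemma times_derivable_comp_affine n f (a b : R) : times_derivable n f ->
  times_derivable n (fun x => f (a * x + b)).
Proof.
elim: n f => [//|n IH] f [df nf]; split=> [x|].
  have [dl _] := is_derive_affine a b x.
  apply/derivable1_diffP.
  apply: (@differentiable_comp _ _ _ _ (fun y => a * y + b) f).
    exact/derivable1_diffP.
  exact/derivable1_diffP.
rewrite (_ : derive1 _ = fun x => a * derive1 f (a * x + b)).
  apply: times_derivableM; [exact: times_derivable_cst|exact: IH].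
by apply/funext => x; rewrite derive1_comp_affine.
Qed.

Lemma derive1_near_cst f (r x : R) : (\forall y \near x, f y = r) -> derive1 f x = 0.
Proof.
move=> fr; rewrite derive1E (@near_eq_derive _ _ _ f (cst r)) ?derive_cst//.
Qed.

End Smooth.

(** * A smooth step function *)

Section Flat.
Context {R : realType}.
Implicit Types (p : {poly R}) (x : R).

(** For p = 1 this is the classical smooth function vanishing to infinite order
    at 0; the polynomial factor p(1/x) makes the family stable under
    differentiation. *)
Definition flat p x : R := if 0 < x then p.[x^-1] * expR (- x^-1) else 0.

(** Each monomial satisfies t^i exp(-t) <= i!, as t^i / i! is one term of the
    exponential series. *)
Lemma horner_expRN_bounded p :
  exists2 C : R, 0 <= C & forall t, 0 <= t -> `|p.[t] * expR (- t)| <= C.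
Proof.
exists (\sum_(i < size p) `|p`_i| * i`!%:R).
  by apply: sumr_ge0 => i _; rewrite mulr_ge0.
move=> t t0; rewrite horner_coef mulr_suml.
apply: le_trans (ler_norm_sum _ _ _) _; apply: ler_sum => i _.
rewrite !normrM -mulrA ler_wpM2l//.
rewrite normrX (ger0_norm t0) (ger0_norm (expR_ge0 _)) expRN ler_pdivrMr ?expR_gt0//.
case: (nat_of_ord i) => [|k].
  by rewrite expr0 fact0 mul1r; have := expR_ge1Dx t; lra.
have := expR_ge1Dxn k t0; rewrite -ler_pdivrMl ?ltr0n ?fact_gt0// mulrC.
by apply: le_trans; rewrite lerDr.
Qed.

(** The quadratic bound at 0 gives both the value 0 and the derivative 0 there; it
    is [horner_expRN_bounded] for the polynomial t^2 p(t) at t = 1/x. *)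
Lemma flat_le p : exists2 C : R, 0 <= C & forall x, `|flat p x| <= C * `|x| * `|x|.
Proof.
have [C C0 pC] := horner_expRN_bounded (p * 'X * 'X).
exists C => // x; rewrite /flat; case: ltP => x0; last by rewrite normr0 !mulr_ge0.
have := pC x^-1; rewrite invr_ge0 ltW// => /(_ isT).
rewrite !hornerMX.
rewrite (_ : _ * expR _ = p.[x^-1] * expR (- x^-1) * x^-1 * x^-1); last by ring.
by rewrite 2!normrM normfV -!ler_pdivlMr ?invr_gt0 ?normr_gt0 ?gt_eqF// !invrK.
Qed.

(** With t = 1/x, the derivative of p(t) exp(-t) is t^2 (p(t) - p'(t)) exp(-t),
    again a member of the family. *)
Lemma is_derive_flat p x :
  is_derive x 1 (flat p) (flat ('X * 'X * (p - p^`())) x).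
Proof.
have [x0|x0|->] := ltgtP x 0.
- rewrite [flat _ x]/flat ltNge (ltW x0)/=.
  apply: (@near_eq_is_derive _ _ _ (cst 0)).
  near=> y; rewrite /flat ltNge.
  suff -> : y <= 0 by [].
  by rewrite ltW//; near: y; exact: lt_nbhsl.
- rewrite [flat _ x]/flat x0.
  have dV : is_derive x 1 (fun y : R => y^-1) (- x ^- 2).
    have x00 : x != 0 by rewrite gt_eqF.
    apply: DeriveDef; first exact: (@derivableV _ _ id).
    rewrite (@deriveV _ _ id)// derive_id /GRing.scale/= mulr1//.
  have [dVd dVe] := dV.
  have d1 : is_derive x 1 (fun y : R => p.[y^-1]) (p^`().[x^-1] * - x ^- 2).
    apply: DeriveDef.
      apply/derivable1_diffP.
      apply: (@differentiable_comp _ _ _ _ (fun y : R => y^-1) (horner p)).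
        exact/derivable1_diffP.
      by apply/derivable1_diffP; exact: derivable_horner.
    rewrite -derive1E (@derive1_comp _ (fun y : R => y^-1) (horner p))//.
      by rewrite -derivE (derive1E (fun y => y^-1)) dVe.
  have d2 : is_derive x 1 (fun y : R => expR (- y^-1)) (expR (- x^-1) * x ^- 2).
    have dN : is_derive x 1 (fun y : R => - y^-1) (x ^- 2).
      by apply: (is_derive_eq (is_deriveN dV)); rewrite opprK.
    have [dNd dNe] := dN.
    apply: DeriveDef.
      apply/derivable1_diffP.
      apply: (@differentiable_comp _ _ _ _ (fun y : R => - y^-1) expR).
        exact/derivable1_diffP.
      by apply/derivable1_diffP; exact: derivable_expR.
    rewrite -derive1E (@derive1_comp _ (fun y : R => - y^-1) expR)//.
    by rewrite !derive1E dNe derive_val.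
  apply: (@near_eq_is_derive R R R (fun y : R => p.[y^-1] * expR (- y^-1))).
    near=> y; rewrite /flat ifT//.
    by near: y; exact: lt_nbhsr.
  apply: (is_derive_eq (is_deriveM d1 d2)).
  rewrite !hornerE /GRing.scale/= expr2 invfM; ring.
- rewrite [flat _ 0]/flat ltxx.
  have [C C0 pC] := flat_le p.
  have f0 : flat p 0 = 0 by rewrite /flat ltxx.
  suff cv : (fun h => h^-1 *: ((flat p \o shift 0) (h *: 1) - flat p 0)) @ 0^' --> 0.
    by apply: DeriveDef; [apply/cvg_ex; exists 0|exact: cvg_lim].
  apply/cvgr0Pnorm_le => e e0; near=> h.
  have h0 : h != 0 by near: h; exact: nbhs_dnbhs_neq.
  rewrite f0 subr0 /= addr0 normrZ normfV ler_pdivrMl ?normr_gt0//.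
  rewrite [h%:A]mulr1 (le_trans (pC h))// [leRHS]mulrC ler_wpM2r//.
  have : `|h| <= e / (C + 1).
    near: h; apply: dnbhs0_le; rewrite divr_gt0//; lra.
  rewrite ler_pdivlMr; last lra.
  by have := normr_ge0 h; nra.
Unshelve. all: by end_near. Qed.

Lemma smooth_flat p : smooth (flat p).
Proof.
move=> n; elim: n p => [//|n IH] p; split=> [x|].
  by have [] := is_derive_flat p x.
rewrite (_ : derive1 _ = flat ('X * 'X * (p - p^`()))); first exact: IH.
by apply/funext => x; rewrite derive1E; have [] := is_derive_flat p x.
Qed.

Lemma flat1_gt0 x : 0 < x -> 0 < flat 1 x.
Proof. by move=> x0; rewrite /flat x0 hornerC mul1r expR_gt0. Qed.

Lemma flat1_eq0 x : x <= 0 -> flat 1 x = 0.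
Proof. by rewrite /flat leNgt => /negbTE ->. Qed.

Lemma flat1_ge0 x : 0 <= flat 1 x.
Proof. by have [/flat1_eq0->//|/flat1_gt0/ltW] := leP x 0. Qed.

(** The argument 1 - x is written in affine form to match
    [times_derivable_comp_affine]. *)
Definition step x : R := flat 1 x * (flat 1 x + flat 1 (- 1 * x + 1))^-1.

(** At least one of x and 1 - x is positive. *)
Lemma step_den_gt0 x : 0 < flat 1 x + flat 1 (- 1 * x + 1).
Proof.
have [x0|x0] := leP x 0.
  by rewrite ltr_wpDl ?flat1_ge0// flat1_gt0//; lra.
by rewrite ltr_pwDl ?flat1_ge0// flat1_gt0.
Qed.

Lemma smooth_step : smooth step.
Proof.
move=> n; apply: times_derivableM; first exact: smooth_flat.
apply: times_derivableV; first by move=> x; rewrite gt_eqF// step_den_gt0.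
apply: times_derivableD; first exact: smooth_flat.
by apply: times_derivable_comp_affine; exact: smooth_flat.
Qed.

Lemma step_eq0 x : x <= 0 -> step x = 0.
Proof. by move=> x0; rewrite /step flat1_eq0// mul0r. Qed.

Lemma step_eq1 x : 1 <= x -> step x = 1.
Proof.
move=> x1; rewrite /step [flat 1 (_ + _)]flat1_eq0; last lra.
by rewrite addr0 divff// gt_eqF// flat1_gt0//; lra.
Qed.

Lemma step_ge0 x : 0 <= step x.
Proof. by rewrite mulr_ge0 ?flat1_ge0// invr_ge0 ltW// step_den_gt0. Qed.

Lemma step_le1 x : step x <= 1.
Proof. by rewrite ler_pdivrMr ?step_den_gt0// mul1r lerDl flat1_ge0. Qed.

End Flat.

(** * Rescaled steps and the averages against their derivatives *)

Section Ramp.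
Context {R : realType}.
Local Notation mu := (@lebesgue_measure R).
Implicit Types (u du : R -> R) (c e x : R).

(** The rise from 0 to 1 takes place on [[c, c + e]]; the affine form of the
    argument is the one of [times_derivable_comp_affine]. *)
Definition ramp c e x : R := step (e^-1 * x - e^-1 * c).

Lemma smooth_ramp c e : smooth (ramp c e).
Proof. by move=> n; apply: times_derivable_comp_affine; exact: smooth_step. Qed.

Lemma ramp_eq0 c e x : 0 < e -> x <= c -> ramp c e x = 0.
Proof.
move=> e0 xc; rewrite /ramp step_eq0// -mulrBr mulr_ge0_le0 ?invr_ge0 ?(ltW e0)//.
by rewrite subr_le0.
Qed.

Lemma ramp_eq1 c e x : 0 < e -> c + e <= x -> ramp c e x = 1.
Proof.
move=> e0 xc; rewrite /ramp step_eq1// -mulrBr -ler_pdivrMl ?invr_gt0//.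
by rewrite invrK mulr1 lerBrDl.
Qed.

Lemma derive1_ramp_out c e x : 0 < e -> ~~ (c <= x <= c + e) ->
  derive1 (ramp c e) x = 0.
Proof.
move=> e0; rewrite negb_and -!ltNge => /orP[xc|cx].
  apply: (@derive1_near_cst _ _ 0); near=> y; apply: ramp_eq0 => //.
  by apply/ltW; near: y; exact: lt_nbhsl.
apply: (@derive1_near_cst _ _ 1); near=> y; apply: ramp_eq1 => //.
by apply/ltW; near: y; exact: lt_nbhsr.
Unshelve. all: by end_near. Qed.

Lemma derive1_step_bounded : exists2 M : R, 0 < M & forall x, `|derive1 step x| <= M.
Proof.
have ss := @smooth_step R.
have cs : {within `[0, 1], continuous (fun x : R => `|derive1 step x|)}.
  apply: continuous_subspaceT => x; apply: continuous_comp; last exact: norm_continuous.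
  exact/smooth_continuous/smooth_derive1.
have [m _ mM] := EVT_max (@ler01 R) cs.
exists (1 + `|derive1 step m|); first by rewrite ltr_pwDl.
move=> x; have [x01|x01] := boolP (x \in `[0, 1]%R).
  by rewrite (le_trans (mM x x01))// lerDr.
rewrite (_ : derive1 step x = 0) ?normr0 ?addr_ge0//.
move: x01; rewrite in_itv/= negb_and -!ltNge => /orP[x0|x1].
  apply: (@derive1_near_cst _ _ 0); near=> y; apply: step_eq0.
  by apply/ltW; near: y; exact: lt_nbhsl.
apply: (@derive1_near_cst _ _ 1); near=> y; apply: step_eq1.
by apply/ltW; near: y; exact: lt_nbhsr.
Unshelve. all: by end_near. Qed.

Lemma derive1_ramp_le c e (M : R) x : 0 < e -> (forall y, `|derive1 step y| <= M) ->
  `|derive1 (ramp c e) x| <= M / e.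
Proof.
move=> e0 sM; rewrite /ramp.
rewrite (@derive1_comp_affine _ step e^-1 (- (e^-1 * c))); last first.
  by move=> y; apply: smooth_derivable; exact: smooth_step.
by rewrite normrM normfV (gtr0_norm e0) mulrC ler_wpM2r// invr_ge0 ltW.
Qed.

Lemma Rintegral_derive1_ramp c e : 0 < e ->
  \int[mu]_(x in `[c, c + e]) derive1 (ramp c e) x = 1.
Proof.
move=> e0; have sr := smooth_ramp c e; have cc : c < c + e by rewrite ltrDl.
rewrite /Rintegral (@continuous_FTC2 _ _ (ramp c e))//.
- by rewrite (@ramp_eq0 c e c)// ramp_eq1// sube0.
- by apply: continuous_subspaceT => x; exact/smooth_continuous/smooth_derive1.
- split=> [x _||]; first exact: smooth_derivable.
  + by apply: cvg_at_right_filter; exact: smooth_continuous.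
  + by apply: cvg_at_left_filter; exact: smooth_continuous.
Qed.

Lemma integrable_mul_continuous u (k : R -> R) : {within `[0, 1], continuous u} ->
  continuous k -> mu.-integrable `[0, 1] (EFin \o (fun x => u x * k x)).
Proof.
move=> cu ck; apply: continuous_compact_integrable; first exact: segment_compact.
by move=> x; apply: cvgM; [exact: cu|exact: (continuous_subspaceT ck)].
Qed.

(** The derivative of a ramp is a kernel of mass 1 supported in [[c, c + e]] and
    bounded by M / e, so averaging u against it produces an error of at most
    (M / e) d on an interval of length e. *)
Lemma ramp_average u c e (p d M : R) : {within `[0, 1], continuous u} ->
    0 < e -> 0 < c -> c + e < 1 -> (forall x, `|derive1 step x| <= M) ->
    (forall x, c <= x <= c + e -> `|u x - p| <= d) ->
  `|\int[mu]_(x in Omega) (u x * derive1 (ramp c e) x) - p| <= d * M.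
Proof.
move=> cu e0 c0 c1 sM up.
pose k := derive1 (ramp c e).
have ck : continuous k by exact/smooth_continuous/smooth_derive1/smooth_ramp.
have sub : `[c, c + e] `<=` `[0, 1].
  by move=> x; rewrite /= !in_itv/= => /andP[cx xc]; lra.
have sub' : `[c, c + e] `<=` (Omega : set R).
  by move=> x; rewrite /= /Omega /= !in_itv/= => /andP[cx xc]; lra.
have iuk : mu.-integrable `[c, c + e] (EFin \o (fun x => u x * k x)).
  by apply: integrableS (integrable_mul_continuous cu ck).
have ik : mu.-integrable `[c, c + e] (EFin \o k).
  apply: continuous_compact_integrable; first exact: segment_compact.
  exact: continuous_subspaceT.
have ipk : mu.-integrable `[c, c + e] (EFin \o (fun x => p * k x)).
  exact: (integrableZl _ p ik).
have iupk : mu.-integrable `[c, c + e] (EFin \o (fun x => u x * k x - p * k x)).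
  exact: (integrableB _ iuk ipk).
have -> : \int[mu]_(x in Omega) (u x * k x) =
          \int[mu]_(x in `[c, c + e]) (u x * k x).
  rewrite Rintegral_mkcond [RHS]Rintegral_mkcond.
  congr Rintegral; apply/funext => x; rewrite /patch.
  have [xc|xc] := boolP (x \in `[c, c + e]%R).
    by rewrite !mem_set//; exact: sub'.
  rewrite (@memNset _ [set` `[c, c + e]%R] _ (negP xc)); case: ifP => // _.
  by rewrite /k derive1_ramp_out ?mulr0// -in_itv.
have -> : p = \int[mu]_(x in `[c, c + e]) (p * k x).
  by rewrite RintegralZl//= Rintegral_derive1_ramp// mulr1.
rewrite -RintegralB//.
apply: (le_trans (le_normr_Rintegral _ iupk)) => //.
have cst_e : \int[mu]_(x in `[c, c + e]) (d * (M / e)) = d * M.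
  rewrite Rintegral_cst//= lebesgue_measure_itv/= lte_fin ltrDl e0.
  by rewrite -EFinD/= addrAC subrr add0r -mulrA divfK// gt_eqF.
rewrite -[leRHS]cst_e; apply: le_Rintegral => //.
- exact: integrable_norm.
- apply: continuous_compact_integrable; first exact: segment_compact.
  by apply: continuous_subspaceT => x; exact: cst_continuous.
- move=> x xc; rewrite -mulrBl normrM ler_pM//; first by apply: up; move: xc; rewrite /= in_itv.
  exact: derive1_ramp_le.
Qed.

End Ramp.

(** * The fundamental theorem of calculus for weak derivatives *)

Section Cutoff.
Context {R : realType}.
Local Notation mu := (@lebesgue_measure R).
Implicit Types (u du : R -> R) (a b c e x : R).

(** The ramps are moved inside by e on each side, which (for 4 e <= b - a) keeps
    the support in [[a + e, b - e]], hence compact in (0,1) even when a = 0 and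
    b = 1. *)
Definition cutoff a b e x : R := ramp (a + e) e x - ramp (b - 2 * e) e x.

Lemma smooth_cutoff a b e : smooth (cutoff a b e).
Proof.
move=> n; rewrite (_ : cutoff a b e =
  fun x => ramp (a + e) e x + -1 * ramp (b - 2 * e) e x).
  apply: times_derivableD; first exact: smooth_ramp.
  by apply: times_derivableM; [exact: times_derivable_cst|exact: smooth_ramp].
by apply/funext => x; rewrite mulN1r.
Qed.

Lemma derive1_cutoff a b e x : derive1 (cutoff a b e) x =
  derive1 (ramp (a + e) e) x - derive1 (ramp (b - 2 * e) e) x.
Proof.
by rewrite !derive1E; apply: deriveB; exact/smooth_derivable/smooth_ramp.
Qed.

Lemma cutoff_eq0 a b e x : 0 < e -> 4 * e <= b - a ->
  ~~ (a + e < x < b - e) -> cutoff a b e x = 0.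
Proof.
move=> e0 eab; rewrite negb_and -!leNgt /cutoff => /orP[xa|bx].
  by rewrite !ramp_eq0 ?subrr//; lra.
by rewrite !ramp_eq1 ?subrr//; lra.
Qed.

Lemma cutoff_eq1 a b e x : 0 < e -> a + 2 * e <= x <= b - 2 * e ->
  cutoff a b e x = 1.
Proof.
by move=> e0 /andP[ax xb]; rewrite /cutoff ramp_eq1 ?ramp_eq0 ?subr0//; lra.
Qed.

Lemma cutoff_le1 a b e x : `|cutoff a b e x| <= 1.
Proof.
have r01 c : 0 <= ramp c e x <= 1 by rewrite step_ge0 step_le1.
have := r01 (a + e); have := r01 (b - 2 * e).
by rewrite /cutoff ler_norml => /andP[? ?] /andP[? ?]; lra.
Qed.

Lemma test_function_cutoff a b e : 0 <= a -> b <= 1 -> 0 < e ->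
  4 * e <= b - a -> test_function (cutoff a b e).
Proof.
move=> a0 b1 e0 eab; split=> [n x|].
  by apply: smooth_derivable_derive1n; exact: smooth_cutoff.
apply: (@subset_trans _ [set` `[a + e, b - e]%R]); last first.
  by move=> x; rewrite /Omega /= !in_itv/= => /andP[? ?]; lra.
rewrite [X in _ `<=` X](closure_id _).1; last exact: itv_closed.
apply: closure_subset => x /=; rewrite in_itv/=.
apply: contraR => xab; rewrite cutoff_eq0//.
by apply: contra xab => /andP[/ltW-> /ltW->].
Qed.

Lemma within_unit_continuous_near u p (d : R) : {within `[0, 1], continuous u} ->
  0 <= p <= 1 -> 0 < d ->
  exists2 r : R, 0 < r &
    forall x, 0 <= x <= 1 -> `|x - p| <= r -> `|u x - u p| <= d.
Proof.
move=> /subspace_continuousP cu p01 d0.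
have := cu p; rewrite /= in_itv/= => /(_ p01) /cvgrPdist_le /(_ d d0).
rewrite near_withinE => /nbhs_ballP[r /= r0 rp].
exists (r / 2); first by rewrite divr_gt0.
move=> x x01 xp; rewrite distrC; apply: rp => /=; last by rewrite ?in_itv.
by rewrite /ball/= distrC (le_lt_trans xp)// ltr_pdivrMr// ltr_pMr// ltr1n.
Qed.

(** The two ramps are averaged separately: both transition intervals,
    [[a + e, a + 2e]] and [[b - 2e, b - e]], are within 2e of a and b, where u is
    close to u a and u b. *)
Lemma integral_derive1_cutoff u a b (e : R^nat) : {within `[0, 1], continuous u} ->
    0 <= a -> a < b -> b <= 1 -> (forall n, 0 < e n) ->
    (forall n, 4 * e n <= b - a) -> e @ \oo --> 0 ->
  \int[mu]_(x in Omega) (u x * derive1 (cutoff a b (e n)) x) @[n --> \oo] -->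
  u a - u b.
Proof.
move=> cu a0 ab b1 e0 eab ecvg.
have [M M0 sM] := @derive1_step_bounded R.
apply/cvgrPdist_le => d d0.
(* Each of the two averages is allowed an error d' M = d / 2. *)
pose d' := d / 2 / M.
have d'0 : 0 < d' by rewrite !divr_gt0.
have dM : d = d' * M + d' * M by rewrite /d' divfK ?gt_eqF//; field.
have [r r0 ua] := within_unit_continuous_near cu (p := a) ltac:(lra) d'0.
have [s s0 ub] := within_unit_continuous_near cu (p := b) ltac:(lra) d'0.
near=> n.
have en0 := e0 n; have enab := eab n.
have enr : e n <= r / 2.
  near: n; apply: (cvgr_le _ ecvg); lra.
have ens : e n <= s / 2.
  near: n; apply: (cvgr_le _ ecvg); lra.
have mO : measurable (Omega : set R) by exact: measurable_itv.
have int_ramp c : mu.-integrable Omega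
    (EFin \o (fun x => u x * derive1 (ramp c (e n)) x)).
  apply: (@integrableS _ _ _ mu `[0, 1]%classic) => //.
  - exact: subset_itv_oo_cc.
  apply: integrable_mul_continuous => //.
  exact/smooth_continuous/smooth_derive1/smooth_ramp.
have -> : \int[mu]_(x in Omega) (u x * derive1 (cutoff a b (e n)) x) =
    \int[mu]_(x in Omega) (u x * derive1 (ramp (a + e n) (e n)) x) -
    \int[mu]_(x in Omega) (u x * derive1 (ramp (b - 2 * e n) (e n)) x).
  rewrite -RintegralB//; apply: eq_Rintegral => x _.
  by rewrite derive1_cutoff mulrBr.
have Ha : `|\int[mu]_(x in Omega) (u x * derive1 (ramp (a + e n) (e n)) x) - u a|
    <= d' * M.
  apply: ramp_average => //; [lra|lra|].
  move=> x /andP[ax xa]; apply: ua; first lra.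
  by rewrite ger0_norm; lra.
have Hb : `|\int[mu]_(x in Omega) (u x * derive1 (ramp (b - 2 * e n) (e n)) x)
    - u b| <= d' * M.
  apply: ramp_average => //; [lra|lra|].
  move=> x /andP[ax xa]; apply: ub; first lra.
  by rewrite ler0_norm; lra.
move: Ha Hb; rewrite distrC dM.
set I1 := \int[mu]_(x in Omega) _; set I2 := \int[mu]_(x in Omega) _ => Ha Hb.
rewrite (_ : u a - u b - (I1 - I2) = (u a - I1) + (I2 - u b)); last by ring.
exact: le_trans (ler_normD _ _) (lerD Ha Hb).
Unshelve. all: by end_near. Qed.

(** Pointwise, the cutoffs are eventually equal to the indicator of ]a, b[, and
    they are dominated by 1. *)
Lemma integral_cutoff du a b (e : R^nat) : mu.-integrable Omega (EFin \o du) ->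
    0 <= a -> a < b -> b <= 1 -> (forall n, 0 < e n) ->
    (forall n, 4 * e n <= b - a) -> e @ \oo --> 0 ->
  \int[mu]_(x in Omega) (du x * cutoff a b (e n) x) @[n --> \oo] -->
  \int[mu]_(x in `]a, b[) du x.
Proof.
move=> idu a0 ab b1 e0 eab ecvg.
have mO : measurable (Omega : set R) by exact: measurable_itv.
have mdu := measurable_int mu idu.
have sub : `]a, b[ `<=` (Omega : set R).
  by move=> x; rewrite /Omega /= !in_itv/= => /andP[? ?]; lra.
have -> : \int[mu]_(x in `]a, b[) du x = \int[mu]_(x in Omega) (du \_ `]a, b[) x.
  by rewrite -Rintegral_mkcondr setIidr.
apply: fine_cvg.
have idab : mu.-integrable Omega (EFin \o (du \_ `]a, b[)).
  rewrite -restrict_EFin; apply/integrable_restrict => //.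
  by rewrite setIidr//; exact: integrableS idu.
rewrite fineK ?integrable_fin_num//.
have mk n : measurable_fun Omega (EFin \o (fun x => du x * cutoff a b (e n) x)).
  apply/measurable_EFinP/measurable_funM; first exact/measurable_EFinP.
  apply: measurable_funTS; apply: continuous_measurable_fun.
  exact/smooth_continuous/smooth_cutoff.
have kpt (x : R) :
    du x * cutoff a b (e n) x @[n --> \oo] --> (du \_ `]a, b[) x.
  rewrite /patch.
  have [xab|xab] := boolP (x \in `]a, b[%R).
    rewrite mem_set//.
    move: (xab); rewrite in_itv/= => /andP[ax xb].
    apply: cvg_near_cst; near=> n.
    rewrite cutoff_eq1 ?mulr1//.
    have enx : e n <= (x - a) / 2.
      near: n; apply: (cvgr_le _ ecvg); lra.
    have eny : e n <= (b - x) / 2.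
      near: n; apply: (cvgr_le _ ecvg); lra.
    lra.
  rewrite (@memNset _ [set` `]a, b[%R] _ (negP xab)).
  apply: cvg_near_cst; near=> n; rewrite cutoff_eq0 ?mulr0//.
  by apply: contra xab; rewrite in_itv/= => /andP[? ?]; have := e0 n; lra.
have kcvg : {ae mu, forall x, Omega x ->
    (EFin \o (fun x => du x * cutoff a b (e n) x)) x @[n --> \oo] -->
    (EFin \o (du \_ `]a, b[)) x}.
  by apply: aeW => x Ox; apply: cvg_EFin; [near=> n|exact: kpt].
have kle : {ae mu, forall x n, Omega x ->
    (`|(du x * cutoff a b (e n) x)%:E| <= `|du x|%:E)%E}.
  apply: aeW => x n Ox; rewrite /= lee_fin normrM.
  by rewrite ler_piMr// cutoff_le1.
by have [] := @dominated_convergence _ _ _ mu Omega mO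
  (fun n => EFin \o (fun x => du x * cutoff a b (e n) x)) (EFin \o (du \_ `]a, b[))
  (EFin \o (fun x => `|du x|)) mk (measurable_int mu idab) kcvg
  (integrable_norm idu) kle.
Unshelve. all: by end_near. Qed.

Lemma weak_derivative_FTC u du a b : {within `[0, 1], continuous u} ->
    mu.-integrable Omega (EFin \o du) -> weak_derivative u du ->
    0 <= a -> a < b -> b <= 1 ->
  \int[mu]_(x in `]a, b[) du x = u b - u a.
Proof.
move=> cu idu wu a0 ab b1.
(* The factor 1/4 leaves room for both ramps and the two margins in [a, b]. *)
pose e (n : nat) : R := (b - a) / 4 * n.+1%:R^-1.
have e0 n : 0 < e n by rewrite mulr_gt0 ?invr_gt0 ?ltr0n//; lra.
have eab n : 4 * e n <= b - a.
  rewrite /e mulrA mulrCA divff// mulr1 ler_piMr//; first lra.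
  by rewrite invf_le1 ?ltr0n// ler1n.
have ecvg : e @ \oo --> 0.
  by rewrite -(mulr0 ((b - a) / 4)); apply: cvgMr; exact: cvg_harmonic.
have h1 := integral_derive1_cutoff cu a0 ab b1 e0 eab ecvg.
have h2 := cvgN (integral_cutoff idu a0 ab b1 e0 eab ecvg).
have E : (fun n => \int[mu]_(x in Omega) (u x * derive1 (cutoff a b (e n)) x)) =
    (fun n => - \int[mu]_(x in Omega) (du x * cutoff a b (e n) x)).
  by apply/funext => n; apply: wu; exact: test_function_cutoff.
rewrite E in h1.
apply: oppr_inj; rewrite opprB.
exact: (cvg_unique (@Rhausdorff R) (h2 _) h1).
Qed.

End Cutoff.

(** * The hat functions and the gradient coupling *)

Section Hat.
Context {R : realType}.
Local Notation mu := (@lebesgue_measure R).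
Implicit Types (u du : R -> R) (s x : R).

(** The absolute values in [phi] have constant signs on [[- s, s]] and on
    [[s, 2 - s]]; the affine forms [a * x + b] match [is_derive_affine]. *)
Lemma phi_left s x : 0 < s < 1 -> - s <= x <= s -> phi s x = s^-1 * x + 0.
Proof.
move=> /andP[s0 s1] /andP[sx xs]; rewrite /phi /Gamma.
rewrite (ler0_norm (_ : x - s <= 0)); last lra.
rewrite (ger0_norm (_ : 0 <= x - - s)); last lra.
rewrite (ger0_norm (_ : 0 <= 1 - s)); last lra.
rewrite (ger0_norm (_ : 0 <= 1 - - s)); last lra.
rewrite (ler0_norm (_ : x - (2 - s) <= 0)); last lra.
rewrite (ler0_norm (_ : 0 - s <= 0)); last lra.
rewrite (ler0_norm (_ : 0 - (2 - s) <= 0)); last lra.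
by field; rewrite !lt0r_neq0//; lra.
Qed.

Lemma phi_right s x : 0 < s < 1 -> s <= x <= 2 - s ->
  phi s x = - (1 - s)^-1 * x + (1 - s)^-1.
Proof.
move=> /andP[s0 s1] /andP[sx xs]; rewrite /phi /Gamma.
rewrite (ger0_norm (_ : 0 <= x - s)); last lra.
rewrite (ger0_norm (_ : 0 <= x - - s)); last lra.
rewrite (ger0_norm (_ : 0 <= 1 - s)); last lra.
rewrite (ger0_norm (_ : 0 <= 1 - - s)); last lra.
rewrite (ler0_norm (_ : x - (2 - s) <= 0)); last lra.
rewrite (ler0_norm (_ : 0 - s <= 0)); last lra.
rewrite (ler0_norm (_ : 0 - (2 - s) <= 0)); last lra.
by field; rewrite !lt0r_neq0//; lra.
Qed.

Lemma derive1_phi_left s x : 0 < s < 1 -> 0 < x < s -> derive1 (phi s) x = s^-1.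
Proof.
move=> s01 /andP[x0 xs]; rewrite derive1E.
have /(@near_eq_derive _ _ _) -> : \forall y \near x, phi s y = s^-1 * y + 0.
  near=> y; apply: phi_left => //.
  have yx : y < s by near: y; exact: lt_nbhsl.
  have y0 : 0 < y by near: y; exact: lt_nbhsr.
  lra.
by have [] := is_derive_affine s^-1 0 x.
Unshelve. all: by end_near. Qed.

Lemma derive1_phi_right s x : 0 < s < 1 -> s < x < 1 ->
  derive1 (phi s) x = - (1 - s)^-1.
Proof.
move=> s01 /andP[sx x1]; rewrite derive1E.
have /(@near_eq_derive _ _ _) -> :
    \forall y \near x, phi s y = - (1 - s)^-1 * y + (1 - s)^-1.
  near=> y; apply: phi_right => //.
  have yx : s < y by near: y; exact: lt_nbhsr.
  have y0 : y < 1 by near: y; exact: lt_nbhsl.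
  lra.
by have [] := is_derive_affine (- (1 - s)^-1) (1 - s)^-1 x.
Unshelve. all: by end_near. Qed.

Lemma coef_split s : 0 < s < 1 -> coef s = s^-1 + (1 - s)^-1.
Proof.
move=> /andP[s0 s1]; rewrite /coef.
by field; rewrite !lt0r_neq0//; lra.
Qed.

(** |du| <= 1 + du^2, and both terms are integrable on a bounded interval. *)
Lemma Lq2_integrable du : Lq 2 du -> mu.-integrable Omega (EFin \o du).
Proof.
move=> du2; have mO : measurable (Omega : set R) by exact: measurable_itv.
have sq := Lfun2_integrable_sqr du2.
move: du2; rewrite /Lq inE => /andP[/[!inE]/= mdu _].
suff : mu.-integrable Omega (EFin \o (du \_ Omega)).
  by apply: eq_integrable => // x xO; rewrite /= /patch xO.
have i1 : mu.-integrable Omega (EFin \o cst (1 : R)).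
  apply: (@integrableS _ _ _ mu `[0, 1]%classic) => //.
    exact: subset_itv_oo_cc.
  apply: continuous_compact_integrable; first exact: segment_compact.
  by apply: continuous_subspaceT => x; exact: cst_continuous.
have sqO : mu.-integrable Omega (EFin \o (fun x => (du \_ Omega) x ^+ 2)).
  exact: integrableS sq.
apply: (@le_integrable _ _ _ mu Omega mO _ _ _ _
  (@integrableD _ _ _ mu Omega mO _ _ i1 sqO)).
  by apply/measurable_EFinP; exact: measurable_funTS.
move=> x _; rewrite /= lee_fin [leRHS]ger0_norm ?addr_ge0 ?sqr_ge0//.
set v := (_ \_ _) x; rewrite ler_norml; apply/andP; split; nra.
Qed.

(** The slope of the hat function is constant on each side of s, so
    [weak_derivative_FTC] applies on (0,s) and on (s,1). *)
Lemma integral_derive1_phi u du s : 0 < s < 1 ->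
    sobolev1_with_derivative 2 u du ->
  \int[mu]_(x in Omega) (du x * derive1 (phi s) x) =
  coef s * u s - u 0 / s - u 1 / (1 - s).
Proof.
move=> s01 [cu _ /Lq2_integrable idu wu]; have [s0 s1] := andP s01.
have mO : measurable (Omega : set R) by exact: measurable_itv.
(* [phi s] has no derivative at s, so [derive1 (phi s) s] is an arbitrary value:
   it is isolated in the summand P, which lives on the null set {s}. *)
pose h x := du x * derive1 (phi s) x.
pose L := du \_ `]0, s[; pose D := du \_ `]s, 1[.
pose P := (cst (h s)) \_ [set s].
have sL : `]0, s[ `<=` (Omega : set R).
  by move=> x; rewrite /Omega /= !in_itv/= => /andP[? ?]; lra.
have sD : `]s, 1[ `<=` (Omega : set R).
  by move=> x; rewrite /Omega /= !in_itv/= => /andP[? ?]; lra.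
have sP : [set s] `<=` (Omega : set R) by move=> x ->; rewrite /Omega /= in_itv.
have iL : mu.-integrable Omega (EFin \o L).
  rewrite -restrict_EFin; apply/integrable_restrict => //.
  by rewrite setIidr//; exact: integrableS idu.
have iD : mu.-integrable Omega (EFin \o D).
  rewrite -restrict_EFin; apply/integrable_restrict => //.
  by rewrite setIidr//; exact: integrableS idu.
have iP : mu.-integrable Omega (EFin \o P).
  rewrite -restrict_EFin; apply/integrable_restrict => //.
  rewrite setIidr//; apply: continuous_compact_integrable; first exact: compact_set1.
  by apply: continuous_subspaceT => x; exact: cst_continuous.
have iL' : mu.-integrable Omega (EFin \o (fun x => s^-1 * L x)).
  exact: (integrableZl _ s^-1 iL).
have iD' : mu.-integrable Omega (EFin \o (fun x => - (1 - s)^-1 * D x)).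
  exact: (integrableZl _ (- (1 - s)^-1) iD).
have iLD : mu.-integrable Omega
    (EFin \o (fun x => s^-1 * L x + - (1 - s)^-1 * D x)).
  exact: (integrableD _ iL' iD').
have -> : \int[mu]_(x in Omega) h x =
    \int[mu]_(x in Omega) (s^-1 * L x + - (1 - s)^-1 * D x + P x).
  apply: eq_Rintegral => x; rewrite inE /Omega /= in_itv/= => /andP[x0 x1].
  rewrite /L /D /P /patch !mem_setE !in_itv/= x0 x1 andbT/= in_set1.
  have [xs|sx|->] := ltgtP x s.
  - by rewrite /h derive1_phi_left ?x0// /point/= mulr0 !addr0 mulrC.
  - by rewrite /h derive1_phi_right ?sx// /point/= mulr0 addr0 add0r mulrC.
  - by rewrite /point/= !mulr0 !add0r.
have EL : \int[mu]_(x in Omega) L x = u s - u 0.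
  by rewrite -Rintegral_mkcondr setIidr// (weak_derivative_FTC cu idu wu)// ltW.
have ED : \int[mu]_(x in Omega) D x = u 1 - u s.
  by rewrite -Rintegral_mkcondr setIidr// (weak_derivative_FTC cu idu wu)// ltW.
have EP : \int[mu]_(x in Omega) P x = 0.
  by rewrite -Rintegral_mkcondr setIidr// Rintegral_set1.
rewrite RintegralD// RintegralD// !RintegralZl// EL ED EP /coef.
by field; rewrite !lt0r_neq0//; lra.
Qed.

End Hat.

Theorem corollary4p3 (R : realType) (f : R -> R) (hf : Lq 1 f) :
  (forall u du : R -> R, sobolev1_with_derivative 2 u du ->
     (exists c : R,
        [/\ 0 <= c,
            forall s : R, 0 < s < 1 ->
              \int[@lebesgue_measure R]_(x in Omega) (f x * phi s x) <=
              \int[@lebesgue_measure R]_(x in Omega) (du x * derive1 (phi s) x)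
                + c * coef s,
            0 <= u 0 - c & 0 <= u 1 - c]) ->
     green_supersolution coef phi f u) /\
  (forall u du : R -> R, sobolev1_with_derivative 2 u du ->
     (exists c : R,
        [/\ 0 <= c,
            forall s : R, 0 < s < 1 ->
              \int[@lebesgue_measure R]_(x in Omega) (du x * derive1 (phi s) x)
                - c * coef s <=
              \int[@lebesgue_measure R]_(x in Omega) (f x * phi s x),
            u 0 + c <= 0 & u 1 + c <= 0]) ->
     green_subsolution coef phi f u).
Proof.
split=> u du su [c [c0 fs u0 u1]]; split; try lra.
- by exists 2; [rewrite ltr1n|exists du].
- move=> s s01; rewrite /coupling !lerD2r (le_trans (fs _ s01))//.
  rewrite (integral_derive1_phi s01 su) (coef_split s01).
  have [s0 s1] := andP s01.
  have sV : 0 < s^-1 by rewrite invr_gt0.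
  have tV : 0 < (1 - s)^-1 by rewrite invr_gt0; lra.
  (* The slack is (u 0 - c) / s + (u 1 - c) / (1 - s). *)
  nra.
- by exists 2; [rewrite ltr1n|exists du].
- move=> s s01; rewrite /coupling !lerD2r (le_trans _ (fs _ s01))//.
  rewrite (integral_derive1_phi s01 su) (coef_split s01).
  have [s0 s1] := andP s01.
  have sV : 0 < s^-1 by rewrite invr_gt0.
  have tV : 0 < (1 - s)^-1 by rewrite invr_gt0; lra.
  nra.
Qed.
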